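(* Let $1\le m<n$ be integers. (1) There exists a deterministic algorithm, using $O(nm^2)$ arithmetic operations, that takes as input a matrix $U\in\mathbb{C}^{n\times m}$ of full column rank and outputs a selection operator $S=S(U)\in\{0,1\}^{n\times m}$ such that $S^TU$ is invertible and the following hold. (1a) If $U^*U=I_m$, then $$\|(S^TU)^{-1}\|_2\le \sqrt{n-m+1}\;\frac{\sqrt{4^m+6m-1}}{3},$$ and for every $f\in\mathbb{C}^n$ $$\|f-U(S^TU)^{-1}S^Tf\|_2\le \sqrt{n}\,O(2^m)\,\|f-UU^*f\|_2,$$ where the constant implied in $O(2^m)$ is absolute (independent of $n,m,U,f$). (1b) If $U$ is only assumed to have full column rank (not necessarily orthonormal columns), then $$\|(S^TU)^{-1}\|_2\le \frac{\sqrt{n-m+1}}{\sigma_{\min}(U)}\;\frac{\sqrt{4^m+6m-1}}{3}.$$ (2) For every $U\in\mathbb{C}^{n\times m}$ with $U^*U=I_m$ there exists a selection operator $S_\star=S_\star(U)$ such that $S_\star^TU$ is invertible and for every $f\in\mathbb{C}^n$ $$\|f-U(S_\star^TU)^{-1}S_\star^Tf\|_2\le\sqrt{1+m(n-m)}\;\|f-UU^*f\|_2 .$$ (3) The selection operators in (1) and (2) do not change if $U$ is replaced by $U\Omega$ with $\Omega$ unitary; that is, the algorithm in (1) and the assignment $U\mapsto S_\star(U)$ in (2) can be taken such that, for every $U\in\mathbb{C}^{n\times m}$ with $U^*U=I_m$ and every unitary $\Omega\in\mathbb{C}^{m\times m}$, $$S(U\Omega)=S(U)\quad\text{and}\quad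 S_\star(U\Omega)=S_\star(U).$$
   Context: A selection operator is an $n\times m$ matrix whose columns are $m$ distinct columns of the $n\times n$ identity matrix; thus $S^TU$ is the $m\times m$ matrix formed by $m$ selected rows of $U$. $I_m$ is the $m\times m$ identity, $U^*$ is the conjugate transpose of $U$, $\|\cdot\|_2$ is the Euclidean vector norm and the induced spectral matrix norm, and $\sigma_{\min}(U)$ is the smallest singular value of $U$. For an input basis $U$ and selection operator $S$ with $S^TU$ invertible, $U(S^TU)^{-1}S^T$ is the (oblique) DEIM projection onto the range of $U$. Complexity is counted in exact arithmetic operations on real/complex numbers (including square roots and comparisons of real numbers), with an absolute implied constant. *)

(* Defs.v *)
From mathcomp Require Export all_boot all_order all_algebra.
From mathcomp Require Export spectral.
From mathcomp Require Export boolp classical_sets reals.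
From mathcomp Require Export complex.

Set Implicit Arguments.
Unset Strict Implicit.
Unset Printing Implicit Defensive.

Import Order.TTheory GRing.Theory Num.Theory.
Export Order.TTheory GRing.Theory Num.Theory.

#[export] Set Implicit Arguments.
#[export] Unset Strict Implicit.
#[export] Unset Printing Implicit Defensive.

Local Open Scope classical_set_scope.
Local Open Scope ring_scope.
Local Open Scope sesquilinear_scope.

Section Norms.
Context {R : realType}.
Local Notation C := R[i].

Definition norm2 n (x : 'cV[C]_n) : R :=
  Num.sqrt (\sum_(i < n) Normc.normc (x i 0) ^+ 2).

Definition spectral_norm n m (A : 'M[C]_(n, m)) : R :=
  sup [set norm2 (A *m x) | x in [set x : 'cV[C]_m | norm2 x <= 1]].

(* For n < m, the m - n extra zero eigenvalues of A^* A are included: the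
   definition is meant for m <= n. *)
Definition singular_values n m (A : 'M[C]_(n, m)) : set R :=
  [set s | 0 <= s /\ eigenvalue (A^t* *m A) (s ^+ 2)%:C%C].

(* For 0 < m the set is finite and nonempty, so inf is a minimum. *)
Definition sigma_min n m (A : 'M[C]_(n, m)) : R := inf (singular_values A).

Definition is_selection n m (S : 'M[C]_(n, m)) : Prop :=
  exists2 p : 'I_m -> 'I_n, injective p &
    forall j : 'I_m, col j S = col (p j) 1%:M.

Definition deim_proj n m (U S : 'M[C]_(n, m)) : 'M[C]_n :=
  U *m invmx (S^T *m U) *m S^T.

End Norms.

(* Algorithms: programs of an imperative language over a memory made of
   one-dimensional arrays of natural numbers and two-dimensional arrays of
   complex numbers, arrays being named by natural numbers.  A program is a
   finite syntactic object that does not depend on the dimensions n, m or on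
   the field: one program handles inputs of all sizes.  The numbers in the
   complex arrays are reachable only through the operations of [cexp] and the
   comparison [BLe]; in particular they cannot be turned into indices.  Loops
   are bounded, so that every program terminates. *)

Inductive iexp : Type :=
| INat of nat
| IGet of nat & iexp              (* array name, index *)
| IAdd of iexp & iexp
| ISub of iexp & iexp             (* truncated *)
| IMul of iexp & iexp.

Inductive cexp : Type :=
| CNat of nat
| CImag
| CGet of nat & iexp & iexp       (* array name, row, column *)
| CAdd of cexp & cexp
| CSub of cexp & cexp
| CMul of cexp & cexp
| CDiv of cexp & cexp
| CConj of cexp
| CSqrt of cexp.

Inductive bexp : Type :=
| BLe of cexp & cexp
| BLt of iexp & iexp.

Inductive prog : Type :=
| Skip
| ISet of nat & iexp & iexp       (* array name, index, new value *)
| CSet of nat & iexp & iexp & cexp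
| Seq of prog & prog
| If of bexp & prog & prog
| For of nat & iexp & prog.       (* [For x e p]: for x[0] = 0, .., e-1 do p *)

Section Semantics.
Context {R : realType}.
Local Notation C := R[i].

Record state := State {
  ints : nat -> nat -> nat;
  nums : nat -> nat -> nat -> C }.

Definition iset (s : state) (a i v : nat) : state :=
  State (fun a' i' => if (a' == a) && (i' == i) then v else ints s a' i')
        (nums s).

Definition cset (s : state) (a i j : nat) (v : C) : state :=
  State (ints s)
    (fun a' i' j' =>
       if [&& a' == a, i' == i & j' == j] then v else nums s a' i' j').

Fixpoint ieval (s : state) (e : iexp) : nat :=
  match e with
  | INat k => k
  | IGet a e1 => ints s a (ieval s e1)
  | IAdd e1 e2 => ieval s e1 + ieval s e2
  | ISub e1 e2 => ieval s e1 - ieval s e2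
  | IMul e1 e2 => ieval s e1 * ieval s e2
  end%N.

(* Division by 0 returns 0; CSqrt is the real square root of the real part of
   its argument (0 if that is negative). *)
Fixpoint ceval (s : state) (e : cexp) : C :=
  match e with
  | CNat k => k%:R
  | CImag => Complex 0 1
  | CGet a i j => nums s a (ieval s i) (ieval s j)
  | CAdd e1 e2 => ceval s e1 + ceval s e2
  | CSub e1 e2 => ceval s e1 - ceval s e2
  | CMul e1 e2 => ceval s e1 * ceval s e2
  | CDiv e1 e2 => ceval s e1 / ceval s e2
  | CConj e1 => conjc (ceval s e1)
  | CSqrt e1 => (Num.sqrt (complex.Re (ceval s e1)))%:C%C
  end.

(* BLe compares real numbers: the real parts of its arguments. *)
Definition beval (s : state) (b : bexp) : bool :=
  match b with
  | BLe e1 e2 => complex.Re (ceval s e1) <= complex.Re (ceval s e2)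
  | BLt e1 e2 => (ieval s e1 < ieval s e2)%N
  end.

(* Cost: one unit for every arithmetic operation, square root, conjugation or
   comparison performed on real/complex numbers; constants, data movement and
   index arithmetic are not counted. *)
Fixpoint ccost (e : cexp) : nat :=
  match e with
  | CNat _ | CImag | CGet _ _ _ => 0
  | CAdd e1 e2 | CSub e1 e2 | CMul e1 e2 | CDiv e1 e2 =>
      (ccost e1 + ccost e2).+1
  | CConj e1 | CSqrt e1 => (ccost e1).+1
  end%N.

Definition bcost (b : bexp) : nat :=
  if b is BLe e1 e2 then (ccost e1 + ccost e2).+1 else 0%N.

(* Final state and total cost.  The bound of a loop is evaluated once, on
   entry. *)
Fixpoint run (p : prog) (s : state) {struct p} : state * nat :=
  match p with
  | Skip => (s, 0)
  | ISet a i e => (iset s a (ieval s i) (ieval s e), 0)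
  | CSet a i j e => (cset s a (ieval s i) (ieval s j) (ceval s e), ccost e)
  | Seq p1 p2 =>
      let r1 := run p1 s in
      let r2 := run p2 r1.1 in
      (r2.1, r1.2 + r2.2)
  | If b p1 p2 =>
      let r := if beval s b then run p1 s else run p2 s in
      (r.1, bcost b + r.2)
  | For x e p1 =>
      iteri (ieval s e)
        (fun k st =>
           let r := run p1 (iset st.1 x 0 k) in (r.1, st.2 + r.2))
        (s, 0)
  end%N.

(* Input: n in ints[0][0], m in ints[1][0], U in nums[0]; all other cells are
   0.  Output: the n x m matrix stored in nums[1]. *)
Definition init_state n m (U : 'M[C]_(n, m)) : state :=
  State
    (fun a i => if i == 0%N then
                  if a == 0%N then n else if a == 1%N then m else 0%N
                else 0%N)
    (fun a i j => if a == 0%N then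
                    if insub i is Some i' then
                      if insub j is Some j' then U i' j' else 0
                    else 0
                  else 0).

Definition output (p : prog) n m (U : 'M[C]_(n, m)) : 'M[C]_(n, m) :=
  \matrix_(i < n, j < m) nums (run p (init_state U)).1 1%N i j.

Definition cost (p : prog) n m (U : 'M[C]_(n, m)) : nat :=
  (run p (init_state U)).2.

End Semantics.

(* Main.v *)
(** The algorithm is Gram-Schmidt on the rows of U with pivoting: at each step
the row of largest norm (smallest index in case of a tie) is selected and all
rows are projected orthogonally to it.  After m steps U = L V, where the rows
v_0, .., v_{m-1} of V are the successive pivot rows, which are orthogonal with
nonincreasing norms, |L_ij| <= 1 by Cauchy-Schwarz, and N = S^T L is unit lower
triangular.  Hence (S^T U)^-1 = V^-1 N^-1, and
- |(N^-1)_ij| <= 2^(i-j-1) for j < i, so that the squared Frobenius norm of N^-1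
  is at most (4^m + 6m - 1)/9;
- |V^-1| = 1/|v_{m-1}|, and testing U on v_{m-1}^* gives
  sigma_min(U) <= sqrt(n-m+1) |v_{m-1}|, because the last column of L vanishes
  on the first m-1 pivots.
For (2), S_star maximizes |det(S^T U)|: by Cramer's rule the entries of
M = U (S^T U)^-1 have modulus at most 1, and M is the identity on the selected
rows.  Both selections depend only on inner products of rows of U, respectively
on moduli of minors, which are invariant under U |-> U Omega. *)
Require Import Defs.
From mathcomp Require Import ring zify.

Local Open Scope ring_scope.
Local Open Scope sesquilinear_scope.

(** * Frobenius norms and triangular inverses *)

Section Frobenius.
Variable C : numClosedFieldType.

Local Notation "''[' u , v ]" := (dotmx u v) : ring_scope.
Local Notation "''[' u ]" := '[u, u]%R : ring_scope.

Definition sqn p q (X : 'M[C]_(p, q)) : C := \sum_i \sum_j `|X i j| ^+ 2.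

Lemma sqn_ge0 p q (X : 'M[C]_(p, q)) : 0 <= sqn X.
Proof. by do 2![apply: sumr_ge0 => ? _]; rewrite exprn_ge0. Qed.

Lemma sqn_col p (x : 'cV[C]_p) : sqn x = \sum_i `|x i 0| ^+ 2.
Proof. by apply: eq_bigr => i _; rewrite big_ord1. Qed.

Lemma sqn_colE p (x : 'cV[C]_p) : sqn x = (x^t* *m x) 0 0.
Proof.
by rewrite sqn_col mxE; apply: eq_bigr => i _; rewrite !mxE normCKC.
Qed.

Lemma dotmx_sum p (u v : 'rV[C]_p) : '[u, v] = \sum_j u 0 j * (v 0 j)^*.
Proof. by rewrite dotmxE mxE; apply: eq_bigr => i _; rewrite !mxE. Qed.

Lemma dotmx_sqn p (u : 'rV[C]_p) : '[u] = sqn u.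
Proof.
by rewrite dotmx_sum /sqn big_ord1; apply: eq_bigr => j _; rewrite normCK.
Qed.

Lemma sqn_trC p q (X : 'M[C]_(p, q)) : sqn (X^t*) = sqn X.
Proof.
rewrite /sqn exchange_big; apply: eq_bigr => i _; apply: eq_bigr => j _.
by rewrite !mxE norm_conjC.
Qed.

Lemma sqnZ p q a (X : 'M[C]_(p, q)) : sqn (a *: X) = `|a| ^+ 2 * sqn X.
Proof.
rewrite /sqn mulr_sumr; apply: eq_bigr => i _; rewrite mulr_sumr.
by apply: eq_bigr => j _; rewrite mxE normrM exprMn.
Qed.

(** Cauchy-Schwarz for each row of [A] against each conjugated column of [B]. With [B] a column
    vector it bounds an operator by its Frobenius norm. *)
Lemma sqn_mulmx p q r (A : 'M[C]_(p, q)) (B : 'M[C]_(q, r)) :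
  sqn (A *m B) <= sqn A * sqn B.
Proof.
rewrite /sqn mulr_suml; apply: ler_sum => i _.
rewrite [X in _ * X]exchange_big mulr_sumr; apply: ler_sum => j _.
have : `|'[row i A, (col j B)^t*]| ^+ 2 <= '[row i A] * '[(col j B)^t*].
  exact: (CauchySchwarz (@dotmx C q) (row i A) ((col j B)^t*)).1.
have -> : '[row i A, (col j B)^t*] = (A *m B) i j.
  by rewrite dotmx_sum mxE; apply: eq_bigr => k _; rewrite !mxE conjCK.
congr (_ <= _ * _); rewrite dotmx_sum; apply: eq_bigr => k _; rewrite !mxE.
  by rewrite normCK.
by rewrite conjCK normCKC.
Qed.

Lemma dotmx_sum_orth m k (v : 'I_k -> 'rV[C]_m) (a : 'I_k -> C) :
  (forall i j, i != j -> '[v i, v j] = 0) ->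
  '[\sum_i a i *: v i] = \sum_i `|a i| ^+ 2 * '[v i].
Proof.
move=> ov; rewrite linear_sumlz /=; apply: eq_bigr => i _.
rewrite linear_sumr (bigD1 i) //= big1 ?addr0 => [|j ji].
  by rewrite linearZl_LR linearZr_LR /= mulrA -normCK.
by rewrite linearZl_LR linearZr_LR /= ov 1?eq_sym// !mulr0.
Qed.

End Frobenius.

(** * Forward substitution for unit lower triangular matrices *)

Section InverseBound.
Variable C : numClosedFieldType.

(* The inverse of a unit lower triangular matrix with entries of modulus at
   most 1 is dominated entrywise by [invw]. *)
Definition invw (i j : nat) : C :=
  if (j < i)%N then 2 ^+ (i - j).-1 else (i == j)%:R.

Lemma invw_ge0 i j : 0 <= invw i j.
Proof. by rewrite /invw; case: ifP => _; rewrite ?exprn_ge0. Qed.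

(** The recurrence of forward substitution when all moduli are extremal. With [d = i - j > 0] it
    reads [1 + 1 + 2 + ... + 2^(d-2) = 2^(d-1)]. *)
Lemma invw_rec i j : invw i j = (i == j)%:R + \sum_(k < i) invw k j.
Proof.
rewrite (_ : \sum_(k < i) invw k j = if (j < i)%N then 2 ^+ (i - j).-1 else 0).
  rewrite /invw; case: ltngtP; by rewrite ?add0r ?addr0.
elim: i => [|i IH]; first by rewrite big_ord0.
rewrite big_ord_recr /= IH /invw ltnS; case: ltngtP => ij.
- rewrite subSn ?(ltnW ij)//= -[in RHS](prednK (n := i - j)) ?subn_gt0//.
  by rewrite exprS; ring.
- by rewrite addr0.
- by rewrite ij subSnn /= add0r.
Qed.

(** Row [i] contributes [1 + (1 + 4 + ... + 4^(i-1)) = (2 + 4^i) / 3], and a second geometric sum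
    runs over the rows. The factor 9 clears both denominators. *)
Lemma sum_invw_sqr m :
  9 * (\sum_(i < m) \sum_(j < m) invw i j ^+ 2) = 4 ^+ m + 6 * m%:R - 1.
Proof.
have row i : (i < m)%N -> 3 * (\sum_(j < m) invw i j ^+ 2) = 2 + 4 ^+ i.
  move=> im; rewrite -(big_mkord xpredT (fun j => invw i j ^+ 2)).
  rewrite (@big_cat_nat _ _ _ i.+1) //=.
  rewrite [X in _ + X](_ : _ = 0) ?addr0; last first.
    rewrite big_nat_cond big1 // => j /andP[/andP[ij _] _].
    rewrite /invw ltnNge (ltnW ij) /=.
    by rewrite (ltn_eqF ij) expr0n.
  rewrite big_nat_recr //= {2}/invw ltnn eqxx expr1n.
  (* Reversing the order of summation turns [4^(i-j-1)] into [4^j]. *)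
  rewrite (_ : \sum_(0 <= j < i) _ = \sum_(0 <= j < i) 4 ^+ j); last first.
    rewrite big_nat_rev /= !big_nat; apply: eq_bigr => j /= ji.
    rewrite /invw add0n ltn_subrL /= (leq_ltn_trans _ ji) //.
    rewrite subnBA ?ji// addnC addnK /= -exprM mulnC exprM.
    by rewrite (_ : 2 ^+ 2 = 4) //; ring.
  rewrite big_mkord mulrDr; have := subrXX 4 (1 : C) i.
  rewrite expr1n (_ : 4 - 1 = 3); last by ring.
  under eq_bigr do rewrite expr1n mulr1.
  have -> : \sum_(i0 < i) (4 : C) ^+ (i.-1 - i0) = \sum_(i0 < i) 4 ^+ i0.
    rewrite (reindex_inj rev_ord_inj) /=; apply: eq_bigr => j _.
    by congr (_ ^+ _); have := ltn_ord j; lia.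
  by move=> <-; ring.
have -> : 9 = 3 * 3 :> C by ring.
rewrite -mulrA mulr_sumr; under eq_bigr => i _ do rewrite row//.
elim: m {row} => [|m IH]; first by rewrite big_ord0; ring.
by rewrite big_ord_recr /= mulrDr IH exprS -natr1; ring.
Qed.

(** Solving row by row and inserting the bounds already found for earlier entries of [y] reproduces
    [invw_rec]. The constant is the squared Frobenius norm of the dominating matrix. *)
Lemma unitrig_solve_le m (N : 'M[C]_m) (x y : 'cV[C]_m) :
  (forall i j : 'I_m, (i < j)%N -> N i j = 0) ->
  (forall i, N i i = 1) -> (forall i j, `|N i j| <= 1) ->
  x = N *m y ->
  sqn y <= (4 ^+ m + 6 * m%:R - 1) / 9 * sqn x.
Proof.
move=> Nt N1 Nle xE.
have yle : forall i : 'I_m, `|y i 0| <= \sum_(j < m) invw i j * `|x j 0|.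
  case=> i; elim/ltn_ind: i => i IH im /=; set i' := Ordinal im.
  have xi : x i' 0 = y i' 0 + \sum_(j < m | (j < i)%N) N i' j * y j 0.
    rewrite xE mxE (bigD1 i') //= N1 mul1r; congr (_ + _).
    rewrite big_mkcond [RHS]big_mkcond; apply: eq_bigr => j _.
    have [->|jni] := eqVneq; first by rewrite /= ltnn.
    case: ltngtP => //= ij; first by rewrite Nt ?mul0r.
    by case/eqP: jni; apply: val_inj.
  have -> : y i' 0 = x i' 0 - \sum_(j < m | (j < i)%N) N i' j * y j 0.
    by rewrite xi addrK.
  rewrite (le_trans (ler_normB _ _))//.
  rewrite [leRHS](eq_bigr (fun j : 'I_m => (i == j :> nat)%:R * `|x j 0| +
     (\sum_(k < m | (k < i)%N) invw k j) * `|x j 0|)); last first.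
    move=> j _; rewrite invw_rec mulrDl; congr (_ + _ * _).
    by rewrite (big_ord_widen m (fun k => invw k j)) // ltnW.
  rewrite big_split /= [X in _ <= X + _](bigD1 i') //= eqxx mul1r.
  rewrite [X in _ + X + _]big1 ?addr0.
    rewrite lerD2l; apply: (le_trans (ler_norm_sum _ _ _)).
    under [leRHS]eq_bigr do rewrite mulr_suml.
    rewrite exchange_big; apply: ler_sum => k /= ki.
    rewrite normrM; apply: (le_trans _ (IH k ki (ltn_ord k))).
    by rewrite (_ : Ordinal _ = k) ?ler_piMl//; apply: val_inj.
  by move=> j ji; rewrite (negPf (_ : _ != _)) ?mul0r// eq_sym.
pose W : 'M[C]_m := \matrix_(i, j) invw i j.
pose ax : 'cV[C]_m := \col_j `|x j 0|.
have -> : sqn x = sqn ax.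
  by rewrite !sqn_col; apply: eq_bigr => i _; rewrite mxE normr_id.
have -> : (4 ^+ m + 6 * m%:R - 1) / 9 = sqn W.
  rewrite -sum_invw_sqr mulrAC mulfV ?mul1r ?pnatr_eq0//.
  apply: eq_bigr => i _; apply: eq_bigr => j _.
  by rewrite mxE ger0_norm ?invw_ge0.
apply: le_trans (sqn_mulmx W ax); rewrite !sqn_col; apply: ler_sum => i _.
have WE : (W *m ax) i 0 = \sum_(j < m) invw i j * `|x j 0|.
  by rewrite mxE; apply: eq_bigr => j _; rewrite !mxE.
have W0 : 0 <= (W *m ax) i 0.
  by rewrite WE sumr_ge0// => j _; rewrite mulr_ge0 ?invw_ge0.
by rewrite (ger0_norm W0) lerXn2r ?nnegrE// WE.
Qed.

End InverseBound.

(** * Pivoted Gram-Schmidt on rows *)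

Definition selmx (C : nzRingType) n m (q : 'I_m -> 'I_n) : 'M[C]_(n, m) :=
  \matrix_(i, j) (i == q j)%:R.

Lemma tr_selmx_mul (C : nzRingType) n m r (q : 'I_m -> 'I_n) (A : 'M[C]_(n, r)) :
  (selmx C q)^T *m A = rowsub q A.
Proof.
apply/matrixP => i j; rewrite !mxE (bigD1 (q i)) //= !mxE eqxx mul1r.
by rewrite big1 ?addr0// => k ki; rewrite !mxE (negPf ki) mul0r.
Qed.

Section PivotedGramSchmidt.
Variable C : numClosedFieldType.
Variables n m : nat.

Local Notation "''[' u , v ]" := (dotmx u v) : ring_scope.
Local Notation "''[' u ]" := '[u, u]%R : ring_scope.

(** Projects all rows onto the orthogonal complement of row [p]. Since [x / 0 = 0], a zero pivot row
    leaves the matrix unchanged. *)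
Definition deflate (A : 'M[C]_(n, m)) (p : 'I_n) : 'M[C]_(n, m) :=
  \matrix_(j, l) (A j l - '[row j A, row p A] / '[row p A] * A p l).

Variables (A : nat -> 'M[C]_(n, m)) (p : nat -> 'I_n).
Hypothesis A_step : forall k, A k.+1 = deflate (A k) (p k).
Hypothesis p_max : forall k j, '[row j (A k)] <= '[row (p k) (A k)].

Let v k := row (p k) (A k).
Let c k j := '[row j (A k), v k] / '[v k].

Lemma row_step k j : row j (A k.+1) = row j (A k) - c k j *: v k.
Proof. by rewrite A_step; apply/rowP => l; rewrite !mxE. Qed.

Lemma row_step_orth k j : '[row j (A k.+1), v k] = 0.
Proof.
rewrite row_step linearBl /= linearZl_LR /=.
have [->|v0] := eqVneq (v k) 0; first by rewrite !linear0r mulr0 subrr.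
by rewrite divfK ?subrr// dnorm_eq0.
Qed.

(** Subtracting a multiple of [v k] preserves orthogonality to an earlier [v i], because [v k] is
    itself a row of [A k] and so falls under the induction hypothesis. *)
Lemma row_orth i k j : (i < k)%N -> '[row j (A k), v i] = 0.
Proof.
elim: k j => // k IH j; rewrite ltnS leq_eqVlt => /predU1P[->|ik].
  exact: row_step_orth.
by rewrite row_step linearBl /= linearZl_LR /= !IH// mulr0 subrr.
Qed.

Lemma pivot_orth i k : i != k -> '[v k, v i] = 0.
Proof.
case: (ltngtP i k) => // [ik|ki] _; first exact: row_orth.
by apply/eqP; rewrite herm_eq0C; apply/eqP/row_orth.
Qed.

Lemma row_pythagoras k j :
  '[row j (A k)] = '[row j (A k.+1)] + `|c k j| ^+ 2 * '[v k].
Proof.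
rewrite -dnormZ -hnormDd; first by rewrite row_step subrK.
by rewrite linearZr_LR /= row_step_orth mulr0.
Qed.

(** By Pythagoras [|c k j|^2 '[v k]] is at most the squared norm of row [j] of [A k], which pivoting
    bounds by ['[v k]]. *)
Lemma coef_le1 k j : v k != 0 -> `|c k j| <= 1.
Proof.
move=> vk0; rewrite -(@expr_le1 _ 2)// -(@ler_pM2r _ '[v k]) ?dnorm_gt0//.
rewrite mul1r; apply: le_trans (p_max k j).
by rewrite row_pythagoras lerDr dnorm_ge0.
Qed.

(** The row that becomes pivot [k.+1] was no longer than [v k] before step [k], and projecting only
    shrinks it. *)
Lemma pivot_norm_anti i k : (i <= k)%N -> '[v k] <= '[v i].
Proof.
elim: k => [|k IH]; first by rewrite leqn0 => /eqP->.
rewrite leq_eqVlt ltnS => /predU1P[->//|/IH]; apply: le_trans.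
apply: le_trans (p_max k (p k.+1)).
by rewrite row_pythagoras lerDl mulr_ge0 ?exprn_ge0 ?dnorm_ge0.
Qed.

Lemma row_expand k j : row j (A 0) = row j (A k) + \sum_(i < k) c i j *: v i.
Proof.
elim: k => [|k IH]; first by rewrite big_ord0 addr0.
by rewrite IH big_ord_recr /= row_step [_ + c k j *: _]addrC addrA subrK.
Qed.

Definition coefmx k : 'M[C]_(n, k) := \matrix_(j, i) c i j.
Definition pivmx k : 'M[C]_(k, m) := \matrix_(i < k) v i.

Lemma mx_expand k : A 0 = A k + coefmx k *m pivmx k.
Proof.
apply/row_matrixP => j; rewrite linearD /= row_mul (row_expand k); congr (_ + _).
by rewrite mulmx_sum_row; apply: eq_bigr => i _; rewrite rowK !mxE.
Qed.

Hypothesis rankA : \rank (A 0) = m.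

(** A zero pivot would, by maximality, make all of [A k] zero; then [A 0] would factor through
    dimension [k < m], against full rank. *)
Lemma pivot_neq0 k : (k < m)%N -> v k != 0.
Proof.
move=> km; apply: contraTneq km => vk0; rewrite -leqNgt -rankA.
have Ak0 : A k = 0.
  apply/row_matrixP => j; rewrite row0; apply/eqP; rewrite -(dnorm_eq0 (@dotmx C m)).
  have := p_max k j; rewrite -/(v k) vk0 linear0r => le0.
  by rewrite eq_le le0 dnorm_ge0.
by rewrite (mx_expand k) Ak0 add0r (leq_trans (mxrankM_maxl _ _))// rank_leq_col.
Qed.

Lemma pivmx_gram : pivmx m *m (pivmx m)^t* = diag_mx (\row_i '[v i]).
Proof.
apply/matrixP => i j; rewrite !mxE.
transitivity '[v i, v j].
  by rewrite dotmx_sum; apply: eq_bigr => l _; rewrite !mxE.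
have [->|ij] := eqVneq i j; first by rewrite mulr1n.
by rewrite mulr0n pivot_orth// eq_sym.
Qed.

Lemma pivmx_unit : pivmx m \in unitmx.
Proof.
have: diag_mx (\row_(i < m) '[v i]) \in unitmx.
  rewrite unitmxE det_diag unitfE prodf_seq_neq0; apply/allP => i _ /=.
  by rewrite mxE dnorm_eq0 pivot_neq0.
by rewrite -pivmx_gram unitmx_mul => /andP[].
Qed.

(** The rows left after [m] steps are orthogonal to all rows of the invertible matrix [pivmx m]. *)
Lemma A_final : A m = 0.
Proof.
have : A m *m (pivmx m)^t* = 0.
  apply/matrixP => j i; rewrite !mxE -[RHS](row_orth j (ltn_ord i)) dotmx_sum.
  by apply: eq_bigr => l _; rewrite !mxE.
move/(canRL (mulmxK _)) => ->; rewrite ?mul0mx//.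
by rewrite map_unitmx unitmx_tr pivmx_unit.
Qed.

Lemma mx_factor : A 0 = coefmx m *m pivmx m.
Proof. by rewrite {1}(mx_expand m) A_final add0r. Qed.

Let q (i : 'I_m) := p i.

Lemma coef_pivot k : (k < m)%N -> c k (p k) = 1.
Proof. by move=> km; rewrite /c divff// dnorm_eq0 pivot_neq0. Qed.

(** A pivot row is annihilated at its own step, and a zero row stays zero. This yields both the
    triangular shape of [N] and the distinctness of the pivots. *)
Lemma row_pivot_eq0 i k : (i < k)%N -> (i < m)%N -> row (p i) (A k) = 0.
Proof.
elim: k => // k IH; rewrite ltnS leq_eqVlt => /predU1P[<-|ik] im.
  by rewrite row_step coef_pivot// scale1r subrr.
by rewrite row_step /c IH// linear0l mul0r scale0r subrr.
Qed.

Lemma coef_pivot_eq0 i k : (i < k)%N -> (i < m)%N -> c k (p i) = 0.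
Proof. by move=> ik im; rewrite /c row_pivot_eq0// linear0l mul0r. Qed.

Lemma pivot_inj : injective q.
Proof.
have key (i k : 'I_m) : (i < k)%N -> q i = q k -> False.
  move=> ik qE; have /eqP[] := pivot_neq0 (ltn_ord k).
  by rewrite /v -[p k]/(q k) -qE row_pivot_eq0.
move=> i k qE; case: (ltngtP i k) => [ik|ki|/val_inj//].
- by case: (key _ _ ik).
- by case: (key _ _ ki).
Qed.

Let N := rowsub q (coefmx m).

Lemma rowsub_factor : rowsub q (A 0) = N *m pivmx m.
Proof. by rewrite mx_factor mul_rowsub_mx. Qed.

Lemma N_trig (i j : 'I_m) : (i < j)%N -> N i j = 0.
Proof. by move=> ij; rewrite !mxE coef_pivot_eq0. Qed.

Lemma N_diag i : N i i = 1.
Proof. by rewrite !mxE coef_pivot. Qed.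

Lemma N_le1 i j : `|N i j| <= 1.
Proof. by rewrite !mxE coef_le1// pivot_neq0. Qed.

Lemma pivot_rows_unit : rowsub q (A 0) \in unitmx.
Proof.
rewrite rowsub_factor unitmx_mul pivmx_unit andbT unitmxE det_trig.
  by rewrite big1 ?unitr1// => i _; rewrite N_diag.
by apply/is_trig_mxP => i j; apply: N_trig.
Qed.

(** Here [t] is a lower bound for the squared least singular value. It is compared with the last
    squared pivot norm [rho], and [rho] with the norms of [w] and [y = pivmx m *m w]; forward
    substitution then bounds [y] by [x], and [rho] drops out. *)
Lemma pivot_bound (t : C) (x : 'cV[C]_m) : (0 < m)%N -> (m <= n)%N -> 0 <= t ->
  (forall z : 'cV[C]_m, t * sqn z <= sqn (A 0 *m z)) ->
  t * sqn (invmx (rowsub q (A 0)) *m x) <=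
    (n%:R - m%:R + 1) * ((4 ^+ m + 6 * m%:R - 1) / 9) * sqn x.
Proof.
move=> m0 mn t0 tle; set w := invmx _ *m x.
have mm : (m.-1 < m)%N by rewrite prednK.
set om := Ordinal mm.
pose rho := '[v m.-1].
have rho0 : 0 < rho by rewrite dnorm_gt0 pivot_neq0.
(* The test vector is the conjugate transpose of the last pivot: by orthogonality [pivmx m] sends it
   to [rho] times the last unit vector, which isolates the last column of [coefmx m]. *)
have tle_rho : t <= rho * (n%:R - m%:R + 1).
  have := tle ((v m.-1)^t*); rewrite sqn_trC -dotmx_sqn -/rho => le1.
  rewrite -(ler_pM2r rho0) (le_trans le1)// mulrAC -expr2.
  rewrite mx_factor -mulmxA.
  have -> : pivmx m *m (v m.-1)^t* = rho *: delta_mx om 0.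
    apply/colP => i; rewrite !mxE andbT.
    transitivity '[v i, v om].
      by rewrite dotmx_sum; apply: eq_bigr => l _; rewrite !mxE.
    have [->|ij] := eqVneq i om; first by rewrite mulr1.
    by rewrite mulr0 pivot_orth// eq_sym.
  rewrite -scalemxAr sqnZ (ger0_norm (ltW rho0)) ler_pM2l ?exprn_gt0//.
  rewrite -colE sqn_col.
  (* These are the first [m - 1] pivot rows, where the last column of [coefmx m] vanishes. Its other
     [n - m + 1] entries have modulus at most 1. *)
  pose T := q @: [set i : 'I_m | (i < m.-1)%N].
  rewrite (bigID (mem T)) /= big1 ?add0r; last first.
    move=> j jT; have /imsetP[k] := jT; rewrite inE => km ->.
    by rewrite !mxE coef_pivot_eq0// normr0 expr0n.
  have -> : n%:R - m%:R + 1 = \sum_(j | j \notin T) (1 : C).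
    rewrite sumr_const (eq_card (_ : _ =i ~: T)); last by move=> j; rewrite !inE.
    rewrite cardsCs finset.setCK card_ord card_imset; last exact: pivot_inj.
    rewrite cardsE (_ : #|_| = m.-1); last first.
      rewrite -sum1_card (eq_bigl (fun i : 'I_m => (i < m.-1)%N))//.
      by rewrite -(big_ord_widen m (fun=> 1%N)) ?leq_pred// sum1_card card_ord.
    rewrite natrB; last by rewrite (leq_trans (leq_pred _)).
    rewrite -{1}(prednK m0) -natr1; ring.
  by apply: ler_sum => j _; rewrite mxE expr_le1// mxE coef_le1// pivot_neq0.
pose y := pivmx m *m w.
(* As pivot norms do not increase, [rho] is the least diagonal entry of the diagonal Gram matrix of
   [pivmx m]. Expanding the conjugate transpose of [w] in the orthogonal rows [v i] reduces the
   claim to single terms. *)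
have wy : rho * sqn w <= sqn y.
  pose a i := (y i 0)^* / '[v i].
  have -> : sqn w = '[\sum_i a i *: v i].
    rewrite dotmx_sqn -sqn_trC; congr sqn.
    have -> : w^t* = y^t* *m invmx ((pivmx m)^t*).
      by rewrite /y (trmx_mul (pivmx m) w) map_mxM mulmxK// map_unitmx unitmx_tr pivmx_unit.
    apply: (canLR (mulmxK _)); first by rewrite map_unitmx unitmx_tr pivmx_unit.
    rewrite [RHS](_ : _ = (\row_i a i *m pivmx m) *m (pivmx m)^t*); last first.
      congr (_ *m _); rewrite mulmx_sum_row; apply: eq_bigr => i _.
      by rewrite rowK mxE.
    rewrite -mulmxA pivmx_gram; apply/rowP => i.
    rewrite mul_mx_diag 2!mxE [in RHS]mxE [in X in _ * X]mxE [in RHS]mxE /a divfK//.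
    by rewrite (dnorm_eq0 (@dotmx C m)) pivot_neq0.
  rewrite dotmx_sum_orth => [|i j ij]; last by rewrite pivot_orth// eq_sym.
  rewrite sqn_col mulr_sumr; apply: ler_sum => i _.
  have vi : 0 < '[v i] by rewrite dnorm_gt0 pivot_neq0.
  have -> : `|a i| ^+ 2 * '[v i] = `|y i 0| ^+ 2 / '[v i].
    rewrite /a normrM norm_conjC exprMn normfV (ger0_norm (ltW vi)).
    by field; rewrite gt_eqF.
  rewrite mulrCA ler_piMr ?exprn_ge0// ler_pdivrMr// mul1r.
  by rewrite pivot_norm_anti// -ltnS prednK.
have yx : sqn y <= (4 ^+ m + 6 * m%:R - 1) / 9 * sqn x.
  apply: (unitrig_solve_le N_trig N_diag N_le1).
  by rewrite /y mulmxA -rowsub_factor /w mulKVmx ?pivot_rows_unit.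
have d0 : 0 <= n%:R - m%:R + 1 :> C.
  by rewrite addr_ge0// subr_ge0 ler_nat.
rewrite -mulrA; apply: le_trans (ler_wpM2l d0 yx).
apply: le_trans (ler_wpM2l d0 wy).
by rewrite mulrA ler_wpM2r ?sqn_ge0// mulrC.
Qed.

End PivotedGramSchmidt.

(** * Maximal volume *)

Section MaximalVolume.
Variable C : numClosedFieldType.
Variables n m : nat.

(** Cramer's rule: the cofactors along row [k] do not see that row, so it may be replaced by row [i]
    of [U]. *)
Lemma det_rowsub_cramer (U : 'M[C]_(n, m)) (q : 'I_m -> 'I_n) i k :
  rowsub q U \in unitmx ->
  (U *m invmx (rowsub q U)) i k * \det (rowsub q U) =
    \det (rowsub (fun j => if j == k then i else q j) U).
Proof.
move=> Bu; rewrite /invmx Bu -scalemxAr mxE mulrAC mulVf ?mul1r -?unitfE//.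
rewrite (expand_det_row _ k) mxE; apply: eq_bigr => l _.
rewrite [in RHS]mxE eqxx [in LHS]mxE; congr (_ * (_ * \det _)).
by apply/matrixP => a b; rewrite !mxE eq_sym (negPf (neq_lift _ _)).
Qed.

(** The maximum ranges over all maps [q'], injective or not, so the exchanged selection is always a
    competitor. *)
Lemma maxvol_le1 (U : 'M[C]_(n, m)) (q : 'I_m -> 'I_n) i k :
  rowsub q U \in unitmx ->
  (forall q', `|\det (rowsub q' U)| <= `|\det (rowsub q U)|) ->
  `|(U *m invmx (rowsub q U)) i k| <= 1.
Proof.
move=> Bu qmax; have d0 : 0 < `|\det (rowsub q U)|.
  by rewrite normr_gt0 -unitfE.
by rewrite -(ler_pM2r d0) mul1r -normrM det_rowsub_cramer.
Qed.

(** The difference between the right side and [(|x| + |y|)^2] is the square [(Q|x| - |y|)^2 / Q]. *)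
Lemma young_norm (Q x y : C) : 0 < Q ->
  `|x - y| ^+ 2 <= (1 + Q) * `|x| ^+ 2 + (1 + Q^-1) * `|y| ^+ 2.
Proof.
move=> Q0; apply: (@le_trans _ _ ((`|x| + `|y|) ^+ 2)).
  by rewrite lerXn2r ?nnegrE ?addr_ge0// ler_normB.
rewrite -subr_ge0 (_ : _ - _ = (Q * `|x| - `|y|) ^+ 2 / Q); last first.
  by field; rewrite gt_eqF.
by rewrite divr_ge0 ?(ltW Q0)// -realEsqr realB ?realM ?normr_real ?gtr0_real.
Qed.

(** Let [a] be the mass of [f] on the selected rows and [b] the rest. Each of the [n - m] other rows
    has interpolant of squared modulus at most [m a]. Young's inequality with weight [Q = m (n - m)]
    then gives [(1 + Q) b + (1 + 1/Q) Q a], which is exactly [(1 + Q) (a + b)]. *)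
Lemma interpolation_residual (M : 'M[C]_(n, m)) (q : 'I_m -> 'I_n) (f : 'cV[C]_n) :
  (0 < m)%N -> (m < n)%N -> injective q ->
  rowsub q M = 1%:M -> (forall i k, `|M i k| <= 1) ->
  sqn (f - M *m rowsub q f) <= (1 + m%:R * (n%:R - m%:R)) * sqn f.
Proof.
move=> m0 mn q_inj MS Mle; set Q := m%:R * _.
have nm0 : 0 < n%:R - m%:R :> C by rewrite subr_gt0 ltr_nat.
have Q0 : 0 < Q by rewrite mulr_gt0 ?ltr0n.
pose a := \sum_k `|f (q k) 0| ^+ 2.
pose T := q @: [set: 'I_m].
have sum_T (F : 'I_n -> C) : \sum_(i in T) F i = \sum_k F (q k).
  rewrite big_imset /=; last by move=> ? ? _ _; apply: q_inj.
  by apply: eq_bigl => k; rewrite inE.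
have sqf : sqn f = a + \sum_(i | i \notin T) `|f i 0| ^+ 2.
  by rewrite sqn_col (bigID (mem T)) /= sum_T.
have entry i : `|(M *m rowsub q f) i 0| ^+ 2 <= m%:R * a.
  have := sqn_mulmx (row i M) (rowsub q f).
  rewrite -row_mul {1}/sqn !big_ord1 mxE => /le_trans; apply.
  rewrite ler_pM ?sqn_ge0//.
    rewrite /sqn big_ord1 -[m in leRHS]card_ord -sumr_const ler_sum// => k _.
    by rewrite mxE expr_le1.
  by rewrite sqn_col /a; under eq_bigr do rewrite mxE.
rewrite sqn_col (bigID (mem T)) /= sum_T big1 ?add0r; last first.
  move=> k _; rewrite mxE [X in _ + X]mxE.
  have -> : (M *m rowsub q f) (q k) 0 = f (q k) 0.
    transitivity ((rowsub q M *m rowsub q f) k 0).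
      by rewrite !mxE; apply: eq_bigr => l _; rewrite !mxE.
    by rewrite MS mul1mx mxE.
  by rewrite subrr normr0 expr0n.
apply: (@le_trans _ _ (\sum_(i | i \notin T)
    ((1 + Q) * `|f i 0| ^+ 2 + (1 + Q^-1) * (m%:R * a)))).
  apply: ler_sum => i _; rewrite mxE [X in _ + X]mxE.
  apply: le_trans (young_norm _ _ Q0) _.
  by rewrite lerD2l ler_pM2l ?entry// addr_gt0 ?invr_gt0.
rewrite big_split /= -mulr_sumr sumr_const (eq_card (_ : _ =i ~: T)); last first.
  by move=> j; rewrite !inE.
rewrite cardsCs finset.setCK card_imset// cardsT !card_ord.
rewrite -[X in _ + X]mulr_natr natrB ?(ltnW mn)//.
rewrite le_eqVlt; apply/orP; left; apply/eqP; rewrite sqf.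
rewrite [(1 + Q^-1) * _ * _](_ : _ = (1 + Q) * a); first by ring.
rewrite -mulrA [X in _ * X](_ : _ = Q * a); last by rewrite /Q; ring.
by rewrite mulrA mulrDl mul1r mulVf ?gt_eqF// addrC.
Qed.

Lemma sqn_sub_le p (x y : 'cV[C]_p) : sqn (x - y) <= 2 * sqn x + 2 * sqn y.
Proof.
rewrite !sqn_col !mulr_sumr -big_split; apply: ler_sum => i _ /=.
by have := @young_norm 1 (x i 0) (y i 0) ltr01; rewrite invr1 !mxE.
Qed.

Lemma sqn_rowsub_le (q : 'I_m -> 'I_n) (g : 'cV[C]_n) : injective q ->
  sqn (rowsub q g) <= sqn g.
Proof.
move=> q_inj; rewrite !sqn_col (bigID (mem (q @: [set: 'I_m]))) /=.
rewrite big_imset /=; last by move=> ? ? _ _; apply: q_inj.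
rewrite [X in _ <= X + _](eq_bigl xpredT); last by move=> k; rewrite inE.
under eq_bigr do rewrite mxE.
by rewrite lerDl sumr_ge0// => i _; rewrite exprn_ge0.
Qed.

Lemma sqn_isometry (U : 'M[C]_(n, m)) (z : 'cV[C]_m) : U^t* *m U = 1%:M ->
  sqn (U *m z) = sqn z.
Proof.
move=> UU; rewrite !sqn_colE trmx_mul map_mxM mulmxA -[_ *m _ *m U]mulmxA.
by rewrite UU mulmx1.
Qed.

Lemma rank_isometry (U : 'M[C]_(n, m)) : U^t* *m U = 1%:M -> \rank U = m.
Proof.
move=> UU; apply/eqP; rewrite eqn_leq rank_leq_col /=.
by rewrite -{1}(mxrank1 C m) -UU mxrankM_maxr.
Qed.

End MaximalVolume.

(** * The program *)

(* Registers: ints 2, 3, 4 hold the loop counters (step, row, column) and ints 5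
   the current pivot row; nums 0 holds the projected matrix, nums 1 the output,
   nums 2 the squared row norms, nums 3 a copy of the pivot row (which the
   projection overwrites in nums 0), nums 4 a projection coefficient. *)

Definition vn := IGet 0 (INat 0).
Definition vm := IGet 1 (INat 0).
Definition vk := IGet 2 (INat 0).
Definition vj := IGet 3 (INat 0).
Definition vl := IGet 4 (INat 0).
Definition vp := IGet 5 (INat 0).

Definition row_norm : prog :=
  For 4 vm (CSet 2 vj (INat 0)
    (CAdd (CGet 2 vj (INat 0)) (CMul (CGet 0 vj vl) (CConj (CGet 0 vj vl))))).

(** The candidate 0 is first compared with itself, after its norm has been computed. The norms stay
    in nums 2 and later supply the denominator of the projection coefficients. *)
Definition find_pivot : prog :=
  Seq (ISet 5 (INat 0) (INat 0))
    (For 3 vn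
      (Seq (CSet 2 vj (INat 0) (CNat 0))
      (Seq row_norm
           (If (BLe (CGet 2 vj (INat 0)) (CGet 2 vp (INat 0)))
              Skip (ISet 5 (INat 0) vj))))).

Definition save_pivot : prog :=
  Seq (For 4 vm (CSet 3 vl (INat 0) (CGet 0 vp vl)))
      (CSet 1 vp vk (CNat 1)).

Definition row_dot_pivot : prog :=
  For 4 vm (CSet 4 (INat 0) (INat 0)
    (CAdd (CGet 4 (INat 0) (INat 0))
       (CMul (CGet 0 vj vl) (CConj (CGet 3 vl (INat 0)))))).

Definition subtract_pivot : prog :=
  For 4 vm (CSet 0 vj vl
    (CSub (CGet 0 vj vl)
       (CMul (CGet 4 (INat 0) (INat 0)) (CGet 3 vl (INat 0))))).

Definition project_rows : prog :=
  For 3 vn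
    (Seq (CSet 4 (INat 0) (INat 0) (CNat 0))
    (Seq row_dot_pivot
    (Seq (CSet 4 (INat 0) (INat 0)
            (CDiv (CGet 4 (INat 0) (INat 0)) (CGet 2 vp (INat 0))))
         subtract_pivot))).

Definition pivoted_gs : prog :=
  For 2 vm (Seq find_pivot (Seq save_pivot project_rows)).

(** * Correctness and cost of the program by loop invariants *)

Section Correctness.
Variable R : realType.
Local Notation C := R[i].

(** [I] and [N] bound the footprint of a computation: the integer and complex arrays it may
    modify. *)
Definition frame (I N : seq nat) (s t : state (R := R)) : Prop :=
  (forall x, x \notin I -> ints t x =1 ints s x) /\
  (forall x, x \notin N -> nums t x =2 nums s x).

Lemma frame_trans I N s t u : frame I N s t -> frame I N t u -> frame I N s u.
Proof.
move=> [fi fn] [gi gn]; split=> x xI.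
  by move=> i; rewrite gi// fi.
by move=> i j; rewrite gn// fn.
Qed.

Lemma frame_sub I N I' N' s t : {subset I <= I'} -> {subset N <= N'} ->
  frame I N s t -> frame I' N' s t.
Proof.
move=> sI sN [fi fn]; split=> x xI.
  by apply: fi; apply: contra xI; apply: sI.
by apply: fn; apply: contra xI; apply: sN.
Qed.

Lemma frame_iset (I N : seq nat) s a i v : a \in I -> frame I N s (iset s a i v).
Proof.
move=> aI; split=> // x xI j /=.
by case: eqP xI => [->|]; rewrite ?aI.
Qed.

Lemma frame_cset (I N : seq nat) s a i j v : a \in N -> frame I N s (cset s a i j v).
Proof.
move=> aI; split=> // x xI i' j' /=.
by case: eqP xI => [->|]; rewrite ?aI.
Qed.

(** Loop rule with an invariant indexed by the iteration number, which holds before the counter is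
    written, and a uniform cost bound [c] per iteration. *)
Lemma run_for (I : nat -> state -> Prop) (N c x : nat) e p (s : state (R := R)) :
  ieval s e = N -> I 0%N s ->
  (forall k t, (k < N)%N -> I k t ->
     I k.+1 (run p (iset t x 0 k)).1 /\ ((run p (iset t x 0 k)).2 <= c)%N) ->
  I N (run (For x e p) s).1 /\ ((run (For x e p) s).2 <= N * c)%N.
Proof.
move=> /= -> I0 step; elim: N step => [//|N IH] step.
have [|IN cN] := IH; first by move=> k t kN; apply: step; apply: ltnW.
move: IN cN => /=; set r := iteri N _ _ => IN cN.
have [? cS] := step N _ (ltnSn N) IN; split=> //.
by rewrite mulSn addnC leq_add.
Qed.

Lemma run_seq p1 p2 (s : state (R := R)) :
  run (Seq p1 p2) s = ((run p2 (run p1 s).1).1,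
                       ((run p1 s).2 + (run p2 (run p1 s).1).2)%N).
Proof. by []. Qed.

Variables n m : nat.

Definition rdot (a : nat -> nat -> C) j p : C :=
  \sum_(0 <= l < m) a j l * conjc (a p l).

Definition argmax_row (a : nat -> nat -> C) (N : nat) : nat :=
  iteri N (fun j b => if complex.Re (rdot a j j) <= complex.Re (rdot a b b)
                      then b else j) 0%N.

Definition project (a : nat -> nat -> C) (p : nat) : nat -> nat -> C :=
  fun j l => a j l - rdot a j p / rdot a p p * a p l.

Lemma argmax_row_lt a N : (0 < N)%N -> (argmax_row a N < N)%N.
Proof.
case: N => // N _; elim: N => [|N IH]; first by rewrite /argmax_row /= if_same.
by rewrite /argmax_row /= -/(argmax_row a N.+1); case: ifP => _ //; apply: leqW.
Qed.

Lemma argmax_row_max a N j : (j < N)%N ->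
  complex.Re (rdot a j j) <=
  complex.Re (rdot a (argmax_row a N) (argmax_row a N)).
Proof.
elim: N => // N IH; rewrite ltnS leq_eqVlt /argmax_row /= -/(argmax_row a N).
have [le1|/ltW lt1] := leP (complex.Re (rdot a N N)).
  by case/predU1P=> [->|/IH].
by case/predU1P=> [->|/IH/le_trans->].
Qed.

Definition dims (s : state (R := R)) := ints s 0 0 = n /\ ints s 1 0 = m.
Definition holds (s : state (R := R)) (a : nat -> nat -> C) :=
  forall j l, (j < n)%N -> (l < m)%N -> nums s 0%N j l = a j l.

Lemma frame_dims I N s t : 0%N \notin I -> 1%N \notin I ->
  frame I N s t -> dims s -> dims t.
Proof. by move=> I0 I1 [fi _] [d0 d1]; rewrite /dims !fi. Qed.


Lemma run_row_norm s j : ints s 1%N 0%N = m -> ints s 3%N 0%N = j ->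
  nums s 2%N j 0%N = 0 ->
  let r := run row_norm s in
  [/\ frame [:: 4]%N [:: 2]%N s r.1,
      (forall i, nums r.1 2%N i 0%N =
         if i == j then \sum_(0 <= l < m) nums s 0%N j l * conjc (nums s 0%N j l)
         else nums s 2%N i 0%N) &
      (r.2 <= m * 3)%N].
Proof.
move=> sm sj s0 r.
have [] := @run_for (fun k t => frame [:: 4]%N [:: 2]%N s t /\
  forall i, nums t 2%N i 0%N =
    if i == j then \sum_(0 <= l < k) nums s 0%N j l * conjc (nums s 0%N j l)
    else nums s 2%N i 0%N) m 3 4 vm (CSet 2 vj (INat 0)
    (CAdd (CGet 2 vj (INat 0)) (CMul (CGet 0 vj vl) (CConj (CGet 0 vj vl))))) s.
- exact: sm.
- split=> // i; case: eqP => [->|//]; by rewrite big_geq.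
- move=> k t km [ft ht]; split=> //; have [fi fn] := ft; split.
    apply: frame_trans ft _ => /=.
    by apply: frame_trans (frame_iset _ _ _ _ _) (frame_cset _ _ _ _ _ _).
  move=> i /=; rewrite fi// sj eqxx andbT.
  have [_|ij] := eqVneq i j; last by rewrite ht (negPf ij).
  by rewrite ht eqxx big_nat_recr //= !fn.
by rewrite /row_norm => -[].
Qed.


(** Per row: three operations per entry for the norm (conjugation, product, sum) and one
    comparison. *)
Lemma run_find_pivot s a : dims s -> holds s a ->
  let r := run find_pivot s in
  [/\ frame [:: 3; 4; 5]%N [:: 2]%N s r.1,
      ints r.1 5%N 0%N = argmax_row a n,
      (forall j, (j < n)%N -> nums r.1 2%N j 0%N = rdot a j j) &
      (r.2 <= n * (3 * m + 1))%N].
Proof.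
move=> [sn sm] ha r.
pose I j t := [/\ frame [:: 3; 4; 5]%N [:: 2]%N s t,
  ints t 5%N 0%N = argmax_row a j &
  forall i, (i < j)%N -> nums t 2%N i 0%N = rdot a i i].
suff [[]] : I n r.1 /\ (r.2 <= n * (3 * m + 1))%N by [].
rewrite /r /find_pivot run_seq; apply: run_for => //.
  by split=> //; apply: frame_iset.
move=> j t jn [ft t5 t2]; rewrite !run_seq.
set u := (run (CSet _ _ _ _) _).1.
have fu : frame [:: 3; 4; 5]%N [:: 2]%N s u.
  apply: frame_trans ft _; rewrite /u /=.
  by apply: frame_trans (frame_iset _ _ _ _ _) (frame_cset _ _ _ _ _ _).
have [] := @run_row_norm u j.
- by rewrite fu.1.
- by [].
- by rewrite /u /= !eqxx.
set w := run row_norm u => fw w2 wc.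
have fsw : frame [:: 3; 4; 5]%N [:: 2]%N s w.1.
  by apply: frame_trans fu _; apply: frame_sub fw => // x; rewrite !inE => ->; rewrite ?orbT.
have w5 : ints w.1 5%N 0%N = argmax_row a j by rewrite fw.1// /u /= t5.
have w3 : ints w.1 3%N 0%N = j by rewrite fw.1.
have w2j i : (i < j.+1)%N -> nums w.1 2%N i 0%N = rdot a i i.
  rewrite w2 ltnS; have [ij _|ij] := eqVneq i j.
    rewrite ij; apply: eq_big_nat => l /andP[_ lm].
    by rewrite fu.2// ha.
  by rewrite leq_eqVlt (negPf ij) /= => ilj; rewrite /u /= (negPf ij) /= t2.
(* The current candidate is among the rows whose norm is already stored; for [j = 0] it is row 0,
   just computed. *)
have bj : (argmax_row a j < j.+1)%N.
  by case: (posnP j) => [->//|/(argmax_row_lt a)/ltnW].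
rewrite [run (If _ _ _) _]/= w3 w5 !w2j// /I /argmax_row /= -/(argmax_row a j).
split; last by case: ifP => _ /=; lia.
by case: ifP => _; split=> //=; apply: frame_trans fsw (frame_iset _ _ _ _ _).
Qed.

Lemma run_save_pivot s a p k : dims s -> holds s a -> (p < n)%N ->
  ints s 5%N 0%N = p -> ints s 2%N 0%N = k ->
  let r := run save_pivot s in
  [/\ frame [:: 4]%N [:: 1; 3]%N s r.1,
      (forall l, (l < m)%N -> nums r.1 3%N l 0%N = a p l),
      (forall i j, nums r.1 1%N i j =
         if (i == p) && (j == k) then 1 else nums s 1%N i j) &
      (r.2 <= 0)%N].
Proof.
move=> [sn sm] ha pn s5 s2 r.
pose I j t := frame [:: 4]%N [:: 3]%N s t /\
  forall i, (i < j)%N -> nums t 3%N i 0%N = a p i.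
have [] := @run_for I m 0 4 vm (CSet 3 vl (INat 0) (CGet 0 vp vl)) s sm.
- by [].
- move=> l t lm [ft t3]; split=> //; split.
    apply: frame_trans ft _ => /=.
    by apply: frame_trans (frame_iset _ _ _ _ _) (frame_cset _ _ _ _ _ _).
  move=> i /=; rewrite ltnS leq_eqVlt ft.1// s5 andbT.
  by have [->|ij] := eqVneq i l; [rewrite ft.2// ha | exact: t3].
rewrite /r /save_pivot run_seq; set u := run (For _ _ _) s => -[fu u3] uc.
have fsu : frame [:: 4]%N [:: 1; 3]%N s u.1.
  by apply: frame_sub fu => // x; rewrite !inE => ->; rewrite ?orbT.
split=> [||i j|].
- by apply: frame_trans fsu (frame_cset _ _ _ _ _ _).
- by move=> l lm /=; rewrite u3.
- by rewrite /= fu.1// fu.1// s5 s2 fu.2.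
- by rewrite addn0; move: uc; rewrite muln0.
Qed.

Lemma run_row_dot_pivot s j : ints s 1%N 0%N = m -> ints s 3%N 0%N = j ->
  nums s 4%N 0%N 0%N = 0 ->
  let r := run row_dot_pivot s in
  [/\ frame [:: 4]%N [:: 4]%N s r.1,
      nums r.1 4%N 0%N 0%N =
        \sum_(0 <= l < m) nums s 0%N j l * conjc (nums s 3%N l 0%N) &
      (r.2 <= m * 3)%N].
Proof.
move=> sm sj s0 r.
have [] := @run_for (fun k t => frame [:: 4]%N [:: 4]%N s t /\
  nums t 4%N 0%N 0%N =
    \sum_(0 <= l < k) nums s 0%N j l * conjc (nums s 3%N l 0%N))
  m 3 4 vm (CSet 4 (INat 0) (INat 0)
    (CAdd (CGet 4 (INat 0) (INat 0))
       (CMul (CGet 0 vj vl) (CConj (CGet 3 vl (INat 0)))))) s sm.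
- by rewrite big_geq.
- move=> k t km [ft ht]; split=> //; have [fi fn] := ft; split.
    apply: frame_trans ft _ => /=.
    by apply: frame_trans (frame_iset _ _ _ _ _) (frame_cset _ _ _ _ _ _).
  by rewrite /= fi// sj ht big_nat_recr //= !fn.
by rewrite /r /row_dot_pivot => -[].
Qed.

Lemma run_subtract_pivot s j : ints s 1%N 0%N = m -> ints s 3%N 0%N = j ->
  let r := run subtract_pivot s in
  [/\ frame [:: 4]%N [:: 0]%N s r.1,
      (forall l, (l < m)%N -> nums r.1 0%N j l =
         nums s 0%N j l - nums s 4%N 0%N 0%N * nums s 3%N l 0%N),
      (forall i l, i != j -> nums r.1 0%N i l = nums s 0%N i l) &
      (r.2 <= m * 2)%N].
Proof.
move=> sm sj r.
pose I k t := [/\ frame [:: 4]%N [:: 0]%N s t,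
  (forall l, (l < k)%N -> nums t 0%N j l =
     nums s 0%N j l - nums s 4%N 0%N 0%N * nums s 3%N l 0%N),
  (forall l, (k <= l)%N -> nums t 0%N j l = nums s 0%N j l) &
  (forall i l, i != j -> nums t 0%N i l = nums s 0%N i l)].
have [] := @run_for I m 2 4 vm (CSet 0 vj vl
    (CSub (CGet 0 vj vl)
       (CMul (CGet 4 (INat 0) (INat 0)) (CGet 3 vl (INat 0))))) s sm.
- by [].
- move=> k t km [ft t_lt t_ge t_ne]; split=> //; have [fi fn] := ft; split.
  + apply: frame_trans ft _ => /=.
    by apply: frame_trans (frame_iset _ _ _ _ _) (frame_cset _ _ _ _ _ _).
  + move=> l; rewrite ltnS leq_eqVlt /= fi// sj eqxx /=.
    have [->|lk] := eqVneq l k; first by rewrite t_ge// !fn.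
    exact: t_lt.
  + by move=> l kl /=; rewrite fi// sj eqxx /= gtn_eqF// t_ge// ltnW.
  + by move=> i l ij /=; rewrite fi// sj (negPf ij) /= t_ne.
by rewrite /r /subtract_pivot => -[].
Qed.

(** Per row: [3 m] operations for the inner product, one division, [2 m] for the subtraction. *)
Lemma run_project_rows s a p : dims s -> holds s a -> (p < n)%N ->
  ints s 5%N 0%N = p -> nums s 2%N p 0%N = rdot a p p ->
  (forall l, (l < m)%N -> nums s 3%N l 0%N = a p l) ->
  let r := run project_rows s in
  [/\ frame [:: 3; 4]%N [:: 0; 4]%N s r.1, holds r.1 (project a p) &
      (r.2 <= n * (5 * m + 1))%N].
Proof.
move=> [sn sm] ha pn s5 s2 s3 r.
(* Rows below [j] are projected and the others still original. The pivot row may already be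
   overwritten, so its entries and norm are read from the copies in nums 3 and nums 2. *)
pose I j t := [/\ frame [:: 3; 4]%N [:: 0; 4]%N s t,
  (forall i l, (i < j)%N -> (l < m)%N -> nums t 0%N i l = project a p i l) &
  (forall i l, (j <= i < n)%N -> (l < m)%N -> nums t 0%N i l = a i l)].
suff [[]] : I n r.1 /\ (r.2 <= n * (5 * m + 1))%N by [].
apply: run_for => //.
move=> j t jn [ft t_lt t_ge]; rewrite !run_seq.
set u := (run (CSet _ _ _ (CNat _)) _).1.
have ftu : frame [:: 3; 4]%N [:: 4]%N t u.
  rewrite /u /=.
  by apply: frame_trans (frame_iset _ _ _ _ _) (frame_cset _ _ _ _ _ _).
have fu : frame [:: 3; 4]%N [:: 0; 4]%N s u.
  apply: frame_trans ft _; apply: frame_sub ftu => // x.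
  by rewrite !inE => ->; rewrite ?orbT.
have [] := @run_row_dot_pivot u j.
- by rewrite fu.1.
- by [].
- by [].
set w := run row_dot_pivot u => fw w4 wc.
have fsw : frame [:: 3; 4]%N [:: 0; 4]%N s w.1.
  by apply: frame_trans fu _; apply: frame_sub fw => // x; rewrite !inE => ->; rewrite ?orbT.
have {}w4 : nums w.1 4%N 0%N 0%N = rdot a j p.
  rewrite w4; apply: eq_big_nat => l /andP[_ lm].
  by rewrite ftu.2// t_ge ?leqnn// fu.2// s3.
set z := (run (CSet _ _ _ (CDiv _ _)) _).1.
have fwz : frame [::] [:: 4]%N w.1 z by rewrite /z /=; exact: frame_cset.
have fsz : frame [:: 3; 4]%N [:: 0; 4]%N s z.
  apply: frame_trans fsw _; apply: frame_sub fwz => // x.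
  by rewrite !inE => ->; rewrite ?orbT.
have z4 : nums z 4%N 0%N 0%N = rdot a j p / rdot a p p.
  by rewrite /z /= w4 fsw.1// s5 fsw.2// s2.
have z0 i l : nums z 0%N i l = nums t 0%N i l by rewrite fwz.2// fw.2// ftu.2.
have [] := @run_subtract_pivot z j.
- by rewrite fsz.1.
- by rewrite fwz.1// fw.1.
set y := run subtract_pivot z => fy yj yi yc.
split; last by rewrite /=; lia.
split=> [|i l|i l].
- apply: frame_trans fsz _; apply: frame_sub fy => x; rewrite !inE => ->//.
  by rewrite orbT.
- rewrite ltnS leq_eqVlt => /predU1P[->|ij] lm.
    by rewrite yj// z0 t_ge ?leqnn// z4 fsz.2// s3.
  by rewrite yi ?ltn_eqF// z0 t_lt.
- move=> /andP[ji ni] lm; rewrite yi ?gtn_eqF// z0 t_ge// ni ltnW//.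
Qed.

Lemma run_pivoted_gs s a : (0 < n)%N -> dims s -> holds s a ->
  (forall i j, nums s 1%N i j = 0) ->
  let A k := iter k (fun b => project b (argmax_row b n)) a in
  let r := run pivoted_gs s in
  (forall i j, nums r.1 1%N i j =
     ((j < m) && (i == argmax_row (A j) n))%N%:R) /\
  (r.2 <= m * (n * (8 * m + 2)))%N.
Proof.
move=> n0 ds ha s1 A r.
pose I k t := [/\ frame [:: 2; 3; 4; 5]%N [:: 0; 1; 2; 3; 4]%N s t,
  holds t (A k) & forall i j, nums t 1%N i j =
     ((j < k) && (i == argmax_row (A j) n))%N%:R].
suff [[]] : I m r.1 /\ (r.2 <= m * (n * (8 * m + 2)))%N by [].
apply: run_for => //; first by case: ds.
move=> k t km [ft tA t1]; rewrite !run_seq; set p := argmax_row (A k) n.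
have pn : (p < n)%N by apply: argmax_row_lt.
set t' := iset t 2 0 k.
have ft' : frame [:: 2; 3; 4; 5]%N [:: 0; 1; 2; 3; 4]%N s t'.
  by apply: frame_trans ft (frame_iset _ _ _ _ _).
have [] := @run_find_pivot t' (A k); [by apply: frame_dims ft' ds | exact: tA |].
set u := run find_pivot t' => fu u5 u2 uc.
have fsu : frame [:: 2; 3; 4; 5]%N [:: 0; 1; 2; 3; 4]%N s u.1.
  apply: frame_trans ft' _; apply: frame_sub fu => x.
    by rewrite !inE => ->; rewrite ?orbT.
  by rewrite !inE => /eqP ->.
have uA : holds u.1 (A k) by move=> i l ? ?; rewrite fu.2// tA.
have [] := @run_save_pivot u.1 (A k) p k _ uA pn u5.
- by apply: frame_dims fsu ds.
- by rewrite fu.1.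
set w := run save_pivot u.1 => fw w3 w1 wc.
have fsw : frame [:: 2; 3; 4; 5]%N [:: 0; 1; 2; 3; 4]%N s w.1.
  apply: frame_trans fsu _; apply: frame_sub fw => x.
    by rewrite !inE => /eqP ->.
  by rewrite !inE => /orP[/eqP->|/eqP->].
have wA : holds w.1 (A k) by move=> i l ? ?; rewrite fw.2// uA.
have [] := @run_project_rows w.1 (A k) p _ wA pn _ _ w3.
- by apply: frame_dims fsw ds.
- by rewrite fw.1.
- by rewrite fw.2// u2.
set y := run project_rows w.1 => fy yA yc.
split.
2: apply: leq_trans (leq_add uc (leq_add wc yc)) _.
2: by rewrite -mulnDr leq_mul2l; lia.
split=> //.
  apply: frame_trans fsw _; apply: frame_sub fy => x.
    by rewrite !inE => /orP[/eqP->|/eqP->].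
  by rewrite !inE => /orP[/eqP->|/eqP->].
move=> i j; rewrite fy.2// w1 fu.2// t1 ltnS [(j <= k)%N]leq_eqVlt.
have [jk|jk] := eqVneq j k; last by rewrite andbF.
by rewrite jk ltnn andbT /= -/p; case: (i == p).
Qed.

End Correctness.

(** * Norms and singular values over the complex numbers *)

Local Open Scope classical_set_scope.
Local Open Scope ring_scope.
Local Open Scope sesquilinear_scope.

Section Norms.
Variable R : realType.
Local Notation C := R[i].

Local Notation "''[' u , v ]" := (dotmx u v) : ring_scope.
Local Notation "''[' u ]" := '[u, u]%R : ring_scope.

Lemma norm2_ge0 n (x : 'cV[C]_n) : 0 <= norm2 x.
Proof. exact: sqrtr_ge0. Qed.

Lemma normc_ge0 (z : C) : 0 <= Normc.normc z.
Proof. by case: z => a b; apply: sqrtr_ge0. Qed.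

Lemma sqn_norm2 n (x : 'cV[C]_n) : sqn x = (norm2 x ^+ 2)%:C%C.
Proof.
rewrite /norm2 sqr_sqrtr; last by rewrite sumr_ge0// => i _; rewrite exprn_ge0// normc_ge0.
rewrite sqn_col rmorph_sum /=; apply: eq_bigr => i _.
by rewrite rmorphXn.
Qed.

Lemma norm2_le n k (b : R) (x : 'cV[C]_n) (y : 'cV[C]_k) : 0 <= b ->
  sqn x <= (b ^+ 2)%:C%C * sqn y -> norm2 x <= b * norm2 y.
Proof.
move=> b0; rewrite !sqn_norm2 -rmorphM /= lecR -exprMn.
by rewrite ler_pXn2r// nnegrE ?mulr_ge0// norm2_ge0.
Qed.

Lemma norm2_0 n : norm2 (0 : 'cV[C]_n) = 0.
Proof.
by rewrite /norm2 big1 ?sqrtr0// => i _; rewrite mxE Normc.normc0 expr0n.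
Qed.

Lemma spectral_norm_le n m (A : 'M[C]_(n, m)) (b : R) : 0 <= b ->
  (forall x, norm2 (A *m x) <= b * norm2 x) -> spectral_norm A <= b.
Proof.
move=> b0 Ab; apply: ge_sup.
  by exists (norm2 (A *m 0)), 0 => //=; rewrite norm2_0.
move=> _ [x /= x1 <-]; apply: le_trans (Ab x) _.
by rewrite ler_piMr.
Qed.

Lemma gram_normal n m (U : 'M[C]_(n, m)) : U^t* *m U \is normalmx.
Proof. by apply/normalmxP; rewrite trmx_mul map_mxM trmxCK. Qed.

(** Writing the eigenvalue as a squared norm shows that it is real and nonnegative, hence the square
    of a singular value. *)
Lemma spectral_diag_gram n m (U : 'M[C]_(n, m)) i :
  let G := U^t* *m U in
  spectral_diag G 0 i = sqn (U *m (row i (spectralmx G))^t*) /\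
  row i (spectralmx G) *m G = spectral_diag G 0 i *: row i (spectralmx G).
Proof.
move=> G; set P := spectralmx G.
have Pu : P \is unitarymx := spectral_unitarymx G.
have GE : G = invmx P *m diag_mx (spectral_diag G) *m P.
  exact/orthomx_spectralP/gram_normal.
have eig : row i P *m G = spectral_diag G 0 i *: row i P.
  rewrite {1}GE !mulmxA -row_mul mulmxV ?spectral_unit// row1 -rowE row_diag_mx.
  by rewrite -scalemxAl -rowE.
split=> //; rewrite sqn_colE trmx_mul map_mxM trmxCK mulmxA -[_ *m _ *m U]mulmxA.
rewrite eig -scalemxAl mxE -dotmxE.
by have /row_unitarymxP -> := Pu; rewrite eqxx mulr1.
Qed.

Lemma singular_spectral n m (U : 'M[C]_(n, m)) i :
  let s := Num.sqrt (complex.Re (spectral_diag (U^t* *m U) 0 i)) in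
  singular_values U s /\ spectral_diag (U^t* *m U) 0 i = (s ^+ 2)%:C%C.
Proof.
move=> s; have [spE eig] := spectral_diag_gram U i.
have sE : spectral_diag (U^t* *m U) 0 i = (s ^+ 2)%:C%C.
  by rewrite /s spE sqn_norm2 /= sqrtr_sqr ger0_norm// norm2_ge0.
split=> //; split; first exact: sqrtr_ge0.
apply/eigenvalueP; exists (row i (spectralmx (U^t* *m U))); first by rewrite eig sE.
have /row_unitarymxP/(_ i i) := spectral_unitarymx (U^t* *m U).
by apply: contra_eq_neq => ->; rewrite linear0l eqxx eq_sym oner_eq0.
Qed.

Lemma sigma_min_ge0 n m (U : 'M[C]_(n, m)) : 0 <= sigma_min U.
Proof. have [U0|U0] := pselect (singular_values U !=set0).
  by apply: lb_le_inf => [//|t []].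
(* Without singular values, [inf] takes its default value 0. *)
by rewrite /sigma_min inf_out// => -[].
 Qed.

Lemma sigma_min_le n m (U : 'M[C]_(n, m)) s : singular_values U s -> sigma_min U <= s.
Proof. by move=> Us; apply: ge_inf => //; exists 0 => t []. Qed.

(** In the unitary eigenbasis of the Gram matrix, [sqn (U *m z)] is a combination of the squared
    moduli of the coordinates of [z] weighted by squared singular values. *)
Lemma sigma_min_bound n m (U : 'M[C]_(n, m)) (z : 'cV[C]_m) :
  (sigma_min U ^+ 2)%:C%C * sqn z <= sqn (U *m z).
Proof.
set G := U^t* *m U; set P := spectralmx G.
have Pu : P \is unitarymx := spectral_unitarymx G.
have GE : G = invmx P *m diag_mx (spectral_diag G) *m P.
  exact/orthomx_spectralP/gram_normal.
have sqP : sqn z = sqn (P *m z).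
  rewrite !sqn_colE trmx_mul map_mxM mulmxA -[z^t* *m _ *m _]mulmxA.
  by rewrite -invmx_unitary// mulVmx ?spectral_unit// mulmx1.
rewrite sqP sqn_col mulr_sumr.
have -> : sqn (U *m z) = \sum_i spectral_diag G 0 i * `|(P *m z) i 0| ^+ 2.
  rewrite sqn_colE trmx_mul map_mxM mulmxA -[_ *m _ *m U]mulmxA -/G.
  have -> : z^t* *m G *m z = (P *m z)^t* *m diag_mx (spectral_diag G) *m (P *m z).
    by rewrite {1}GE invmx_unitary// trmx_mul map_mxM !mulmxA.
  rewrite mxE.
  apply: eq_bigr => i _; rewrite mul_mx_diag 3!mxE normCKC mulrA.
  by rewrite [_ * spectral_diag _ _ _]mulrC.
apply: ler_sum => i _; rewrite ler_wpM2r ?exprn_ge0//.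
have [Us ->] := singular_spectral U i.
by rewrite lecR ler_pXn2r ?nnegrE ?sqrtr_ge0 ?sigma_min_ge0// sigma_min_le.
Qed.

(** A left inverse of [U] with squared Frobenius norm [w] forces [1 <= w s^2] for every singular
    value [s]. The resulting bound is uniform, so it passes to the infimum. *)
Lemma sigma_min_gt0 n m (U : 'M[C]_(n, m)) : (0 < m)%N -> \rank U = m ->
  0 < sigma_min U.
Proof.
move=> m0 rU; have WU : pinvmx U *m U = 1%:M by rewrite mulVpmx// /row_full rU.
pose w : R := complex.Re (sqn (pinvmx U)).
have wE : sqn (pinvmx U) = w%:C%C.
  by rewrite RRe_real// ger0_real// sqn_ge0.
have w0 : 0 <= w by rewrite -lecR -wE sqn_ge0.
(* Adding 1 makes the root positive without a proof that [w] is. *)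
apply: (@lt_le_trans _ _ (Num.sqrt (w + 1))^-1).
  by rewrite invr_gt0 sqrtr_gt0 ltr_pwDr.
apply: lb_le_inf.
  by exists (Num.sqrt (complex.Re (spectral_diag (U^t* *m U) 0 (Ordinal m0))));
    case: (singular_spectral U (Ordinal m0)).
move=> s [s0 /eigenvalueP[v vG v0]].
have vn : 0 < '[v] by rewrite dnorm_gt0.
have Uv : sqn (U *m v^t*) = (s ^+ 2)%:C%C * '[v].
  rewrite sqn_colE trmx_mul map_mxM trmxCK mulmxA -[_ *m _ *m U]mulmxA vG.
  by rewrite -scalemxAl mxE -dotmxE.
have := sqn_mulmx (pinvmx U) (U *m v^t*).
rewrite mulmxA WU mul1mx Uv sqn_trC -dotmx_sqn wE mulrA -{1}['[v]]mul1r ler_pM2r//.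
rewrite -rmorphM -(rmorph1 (real_complex R)) lecR => le1.
rewrite -div1r ler_pdivrMr ?sqrtr_gt0 ?ltr_pwDr//.
rewrite -(@ler_pXn2r _ 2) ?nnegrE ?mulr_ge0 ?sqrtr_ge0// expr1n exprMn.
rewrite sqr_sqrtr ?addr_ge0// (le_trans le1)// mulrC ler_wpM2l ?exprn_ge0//.
by rewrite lerDl.
Qed.

End Norms.

(** * Output of the program *)

Section Output.
Variable R : realType.
Local Notation C := R[i].
Variables n m : nat.

Local Notation "''[' u , v ]" := (dotmx u v) : ring_scope.
Local Notation "''[' u ]" := '[u, u]%R : ring_scope.

Definition mxfun (a : nat -> nat -> C) : 'M[C]_(n, m) := \matrix_(j, l) a j l.

Lemma rdotE a (i j : 'I_n) : rdot m a i j = '[row i (mxfun a), row j (mxfun a)].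
Proof.
rewrite /rdot big_mkord dotmx_sum; apply: eq_bigr => l _.
by rewrite !mxE.
Qed.

Lemma mxfun_project a (p : 'I_n) : mxfun (project m a p) = deflate (mxfun a) p.
Proof. by apply/matrixP => j l; rewrite !mxE /project !rdotE. Qed.

Hypothesis n0 : (0 < n)%N.

Definition pivot_row (a : nat -> nat -> C) : 'I_n := Ordinal (argmax_row_lt m a n0).

(** The program compares real parts only, which suffices because squared norms are real. *)
Lemma pivot_row_max a j :
  '[row j (mxfun a)] <= '[row (pivot_row a) (mxfun a)].
Proof.
have := argmax_row_max m a (ltn_ord j).
rewrite (rdotE a j j) (rdotE a (pivot_row a) (pivot_row a)) => le1.
by rewrite lecE le1 andbT !(ger0_Im (dnorm_ge0 _ _)).
Qed.

(** The choice, ties included, depends on the row norms alone; this drives the unitary invariance of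
    the algorithm. *)
Lemma pivot_row_ext a b :
  (forall i, '[row i (mxfun a)] = '[row i (mxfun b)]) -> pivot_row a = pivot_row b.
Proof.
move=> ab; apply: val_inj => /=.
have ab' j : (j < n)%N -> rdot m a j j = rdot m b j j.
  by move=> jn; have := ab (Ordinal jn); rewrite -!rdotE.
suff key N : (N <= n)%N -> argmax_row m a N = argmax_row m b N by exact: key.
elim: N => // N IH Nn; rewrite /argmax_row /= -/(argmax_row m a N) -/(argmax_row m b N).
rewrite (IH (ltnW Nn)) !ab'//; case: N {IH} Nn => // N Nn.
by rewrite (leq_trans (argmax_row_lt _ _ _))// ltnW.
Qed.

Definition gs_iter (U : 'M[C]_(n, m)) k : nat -> nat -> C :=
  iter k (fun b => project m b (argmax_row m b n)) (nums (init_state U) 0%N).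

Definition gs_pivot (U : 'M[C]_(n, m)) k : 'I_n := pivot_row (gs_iter U k).

Lemma gs_iter0 U : mxfun (gs_iter U 0) = U.
Proof.
by apply/matrixP => i j; rewrite mxE /= !valK.
Qed.

Lemma gs_iterS U k :
  mxfun (gs_iter U k.+1) = deflate (mxfun (gs_iter U k)) (gs_pivot U k).
Proof. exact: mxfun_project. Qed.

Lemma run_init_gs (U : 'M[C]_(n, m)) :
  let r := run pivoted_gs (init_state U) in
  (forall i j, nums r.1 1%N i j =
     ((j < m) && (i == argmax_row m (gs_iter U j) n))%N%:R) /\
  (r.2 <= m * (n * (8 * m + 2)))%N.
Proof. exact: run_pivoted_gs. Qed.

Lemma output_gs (U : 'M[C]_(n, m)) :
  output pivoted_gs U = selmx C (fun j : 'I_m => gs_pivot U j).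
Proof.
by apply/matrixP => i j; rewrite !mxE (run_init_gs U).1 ltn_ord.
Qed.

Lemma cost_gs (U : 'M[C]_(n, m)) : (cost pivoted_gs U <= 10 * (n * m ^ 2))%N.
Proof.
apply: leq_trans (run_init_gs U).2 _.
by case: m => // k; nia.
Qed.

Lemma deflate_unitary (X : 'M[C]_(n, m)) p (Om : 'M[C]_m) : Om \is unitarymx ->
  deflate (X *m Om) p = deflate X p *m Om.
Proof.
move=> Ou.
have dotO u v : '[u *m Om, v *m Om] = '[u, v].
  by rewrite !dotmxE trmx_mul map_mxM mulmxA mulmxtVK.
have rowE (Y : 'M[C]_(n, m)) j :
    row j (deflate Y p) = row j Y - ('[row j Y, row p Y] / '[row p Y]) *: row p Y.
  by apply/rowP => l; rewrite !mxE.
apply/row_matrixP => j; rewrite row_mul !rowE !row_mul !dotO.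
by rewrite mulmxBl scalemxAl.
Qed.

Lemma gs_iter_unitary (U : 'M[C]_(n, m)) (Om : 'M[C]_m) k : Om \is unitarymx ->
  mxfun (gs_iter (U *m Om) k) = mxfun (gs_iter U k) *m Om /\
  gs_pivot (U *m Om) k = gs_pivot U k.
Proof.
move=> Ou.
have piv i : mxfun (gs_iter (U *m Om) i) = mxfun (gs_iter U i) *m Om ->
    gs_pivot (U *m Om) i = gs_pivot U i.
  move=> E; apply: pivot_row_ext => j.
  by rewrite E row_mul !dotmxE trmx_mul map_mxM mulmxA mulmxtVK.
suff E : mxfun (gs_iter (U *m Om) k) = mxfun (gs_iter U k) *m Om.
  by split=> //; apply: piv.
elim: k => [|k IH]; first by rewrite !gs_iter0.
by rewrite !gs_iterS (piv _ IH) IH deflate_unitary.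
Qed.

Lemma output_gs_unitary (U : 'M[C]_(n, m)) (Om : 'M[C]_m) : Om \is unitarymx ->
  output pivoted_gs (U *m Om) = output pivoted_gs U.
Proof.
move=> Ou; rewrite !output_gs; apply/matrixP => i j; rewrite !mxE.
by rewrite (gs_iter_unitary U j Ou).2.
Qed.

Lemma is_selection_selmx (q : 'I_m -> 'I_n) : injective q ->
  is_selection (selmx C q).
Proof. by move=> q_inj; exists q => // j; apply/colP => i; rewrite !mxE. Qed.

(** The oblique projection fixes the columns of [U], so the component of [f] produced by [U *m U^t*]
    cancels from the error. *)
Lemma deim_residual (U : 'M[C]_(n, m)) (S : 'M[C]_(n, m)) (f : 'cV[C]_n) :
  S^T *m U \in unitmx -> let g := f - U *m U^t* *m f in
  f - deim_proj U S *m f = g - deim_proj U S *m g.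
Proof.
move=> Bu g; have DU : deim_proj U S *m U = U.
  by rewrite /deim_proj -mulmxA -mulmxA mulVmx// mulmx1.
by rewrite /g mulmxBr !mulmxA DU opprB addrA subrK.
Qed.

(** * The algorithm on matrices of full column rank *)

Section FullRank.
Hypotheses (m0 : (0 < m)%N) (mn : (m < n)%N).
Variable U : 'M[C]_(n, m).
Hypothesis rU : \rank U = m.

Let A k := mxfun (gs_iter U k).
Let q (j : 'I_m) := gs_pivot U j.
Let A_step k : A k.+1 = deflate (A k) (gs_pivot U k) := gs_iterS U k.
Let p_max k j : '[row j (A k)] <= '[row (gs_pivot U k) (A k)] :=
  pivot_row_max (gs_iter U k) j.
Let rA : \rank (A 0) = m.
Proof. by rewrite /A gs_iter0. Qed.

Lemma gs_pivot_inj : injective q.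
Proof. exact: (pivot_inj A_step p_max rA). Qed.

Lemma gs_rows_unit : rowsub q U \in unitmx.
Proof. by have := pivot_rows_unit A_step p_max rA; rewrite {1}/A gs_iter0. Qed.

Lemma gs_inv_bound (t : C) (x : 'cV[C]_m) : 0 <= t ->
  (forall z : 'cV[C]_m, t * sqn z <= sqn (U *m z)) ->
  t * sqn (invmx (rowsub q U) *m x) <=
    (n%:R - m%:R + 1) * ((4 ^+ m + 6 * m%:R - 1) / 9) * sqn x.
Proof.
move=> t0 tle; have := pivot_bound A_step p_max rA x m0 (ltnW mn) t0.
by rewrite {1 2}/A gs_iter0; apply.
Qed.

(** The parameter [s] serves both norm bounds: 1 for orthonormal columns, [sigma_min U] in
    general. *)
Lemma gs_spectral_le (s : R) : 0 < s ->
  (forall z : 'cV[C]_m, (s ^+ 2)%:C%C * sqn z <= sqn (U *m z)) ->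
  spectral_norm (invmx (rowsub q U)) <=
    Num.sqrt (n%:R - m%:R + 1) / s * (Num.sqrt (4 ^+ m + 6 * m%:R - 1) / 3).
Proof.
move=> s0 sle.
have d0 : 0 <= n%:R - m%:R + 1 :> R by rewrite addr_ge0// subr_ge0 ler_nat ltnW.
have g0 : 0 <= 4 ^+ m + 6 * m%:R - 1 :> R.
  by rewrite subr_ge0 ler_wpDr ?mulr_ge0// exprn_ege1// ler1n.
set b := _ * _; have b0 : 0 <= b by rewrite /b !mulr_ge0 ?sqrtr_ge0// invr_ge0 ?(ltW s0).
apply: spectral_norm_le => // x; apply: norm2_le => //.
have s20 : (0 : C) < (s ^+ 2)%:C%C by rewrite ltcR exprn_gt0.
rewrite -(ler_pM2l s20) mulrA -rmorphM /=.
apply: le_trans (gs_inv_bound x (ltW s20) sle) _.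
rewrite le_eqVlt; apply/orP; left; apply/eqP; congr (_ * _).
rewrite /b !exprMn !exprVn !sqr_sqrtr//.
rewrite (_ : _ * (_ * _) = (n%:R - m%:R + 1) * ((4 ^+ m + 6 * m%:R - 1) / 9)); last first.
  by field; rewrite gt_eqF.
rewrite rmorphM rmorphD rmorphB !rmorph_nat rmorphM /= fmorphV.
by rewrite rmorphB rmorphD rmorphM rmorphXn !rmorph_nat rmorph1.
Qed.

End FullRank.


End Output.

(** * Error bounds *)

Section DeimError.
Variable R : realType.
Local Notation C := R[i].
Variables n m : nat.
Hypotheses (m0 : (0 < m)%N) (mn : (m < n)%N).
Variable U : 'M[C]_(n, m).
Hypothesis UU : U^t* *m U = 1%:M.

Let n0 : (0 < n)%N.
Proof. exact: ltn_trans mn. Qed.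

(** The projected residual has squared norm at most [n 4^m sqn g]. Splitting the difference costs a
    factor 2 on each term, for a total of [4 n 4^m], whose root gives the constant 2. *)
Lemma gs_deim_error (f : 'cV[C]_n) :
  norm2 (f - deim_proj U (selmx C (fun j : 'I_m => gs_pivot n0 U j)) *m f)
    <= Num.sqrt n%:R * (2 * 2 ^+ m) * norm2 (f - U *m U^t* *m f).
Proof.
set S := selmx _ _; have rU := rank_isometry UU.
have Bu := gs_rows_unit n0 rU; have q_inj := gs_pivot_inj (n0 := n0) rU.
have SU : S^T *m U = rowsub (fun j : 'I_m => gs_pivot n0 U j) U by exact: tr_selmx_mul.
rewrite deim_residual ?SU//; set g := f - _.
apply: norm2_le; first by rewrite !mulr_ge0 ?sqrtr_ge0 ?exprn_ge0.
apply: le_trans (sqn_sub_le _ _) _.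
have Dg : sqn (deim_proj U S *m g) <= n%:R * 4 ^+ m * sqn g.
  rewrite /deim_proj -!mulmxA sqn_isometry// SU tr_selmx_mul.
  have := gs_inv_bound n0 m0 mn rU (rowsub (fun j : 'I_m => gs_pivot n0 U j) g) ler01.
  rewrite mul1r => /(_ _)/le_trans; apply.
    by move=> z; rewrite mul1r sqn_isometry.
  rewrite ler_pM ?sqn_ge0//; last exact: sqn_rowsub_le.
    rewrite mulr_ge0 ?divr_ge0//.
      by rewrite addr_ge0// subr_ge0 ler_nat ltnW.
    by rewrite subr_ge0 ler_wpDr ?mulr_ge0// exprn_ege1// ler1n.
  (* This gives [4^m + 6 m - 1 <= 9 * 4^m], which absorbs the denominator 9; also
     [n - m + 1 <= n]. *)
  have m4 : m%:R <= 4 ^+ m :> C by rewrite -natrX ler_nat ltnW// ltn_expl.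
  rewrite ler_pM ?divr_ge0//.
  - by rewrite addr_ge0// subr_ge0 ler_nat ltnW.
  - by rewrite subr_ge0 ler_wpDr ?mulr_ge0// exprn_ege1// ler1n.
  - by rewrite -addrA gerDl addrC subr_le0 ler1n.
  rewrite ler_pdivrMr// lerBlDr.
  rewrite (_ : _ * 9 = 4 ^+ m + 6 * 4 ^+ m + 2 * 4 ^+ m); last by ring.
  by rewrite -!addrA lerD2l ler_wpDr ?ler_pM2l// !addr_ge0// mulr_ge0// exprn_ge0.
pose X : C := n%:R * 4 ^+ m.
have -> : ((Num.sqrt n%:R * (2 * 2 ^+ m)) ^+ 2)%:C%C = 4 * X.
  rewrite exprMn sqr_sqrtr ?ler0n// exprMn -exprM mulnC exprM.
  rewrite (_ : 2 ^+ 2 = 4); last by ring.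
  by rewrite !rmorphM rmorphXn !rmorph_nat /X; ring.
have -> : 4 * X * sqn g = 2 * (X * sqn g) + 2 * (X * sqn g) by ring.
apply: lerD; rewrite (ler_pM2l (ltr0n C 2)); last exact: Dg.
clear Dg.
rewrite ler_peMl ?sqn_ge0// /X mulr_ege1 ?ler1n//.
by rewrite exprn_ege1// ler1n.
Qed.

End DeimError.

(** * Existence, error bound and invariance of the maximal volume selection *)

Section MaximalVolumeSelection.
Variable R : realType.
Local Notation C := R[i].
Variables n m : nat.
Hypotheses (m0 : (0 < m)%N) (mn : (m < n)%N).

Let n0 : (0 < n)%N.
Proof. exact: ltn_trans mn. Qed.

(** Values are taken in [R], which is totally ordered, so that an arg max over the finite set of
    maps exists. *)
Definition volume (U : 'M[C]_(n, m)) (q : {ffun 'I_m -> 'I_n}) : R :=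
  Normc.normc (\det (rowsub q U)).

Definition maxvol_rows (U : 'M[C]_(n, m)) : {ffun 'I_m -> 'I_n} :=
  [arg max_(q > [ffun=> Ordinal n0]) volume U q]%O.

Lemma maxvol_rows_max U (q : 'I_m -> 'I_n) :
  `|\det (rowsub q U)| <= `|\det (rowsub (maxvol_rows U) U)|.
Proof.
have -> : rowsub q U = rowsub [ffun j => q j] U.
  by apply/matrixP => i j; rewrite !mxE ffunE.
rewrite /maxvol_rows; case: Order.TotalTheory.arg_maxP => // p _ pmax.
have : volume U [ffun j => q j] <= volume U p by exact: pmax.
by rewrite -lecR.
Qed.

(** The arg max sees [U] only through the function [volume U], and [|det Om| = 1] leaves that
    function unchanged. *)
Lemma maxvol_rows_unitary (U : 'M[C]_(n, m)) (Om : 'M[C]_m) : Om \is unitarymx ->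
  maxvol_rows (U *m Om) = maxvol_rows U.
Proof.
move=> Ou; rewrite /maxvol_rows (_ : volume (U *m Om) = volume U)//.
apply/funext => q; rewrite /volume -mul_rowsub_mx det_mulmx Normc.normcM.
suff -> : Normc.normc (\det Om) = 1 by rewrite mulr1.
have /unitarymxP/(congr1 determinant) := Ou.
rewrite det_mulmx det_map_mx det_tr det1 -normCK => /eqP.
by rewrite -(expr1n C 2) eqrXn2// => /eqP [].
Qed.

Variable U : 'M[C]_(n, m).
Hypothesis UU : U^t* *m U = 1%:M.

(** The pivots of Gram-Schmidt already give a nonzero minor, so the maximal one is nonzero. *)
Lemma maxvol_rows_unit : rowsub (maxvol_rows U) U \in unitmx.
Proof.
have := gs_rows_unit n0 (rank_isometry UU).
rewrite !unitmxE !unitfE -!normr_gt0 => /lt_le_trans; apply.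
exact: maxvol_rows_max.
Qed.

Lemma maxvol_rows_inj : injective (maxvol_rows U).
Proof.
move=> i j ij; apply/eqP; apply: contraTT maxvol_rows_unit => nij.
rewrite unitmxE unitfE negbK; apply/eqP/(determinant_alternate nij) => l.
by rewrite !mxE ij.
Qed.

Lemma maxvol_deim_error (f : 'cV[C]_n) :
  norm2 (f - deim_proj U (selmx C (maxvol_rows U)) *m f)
    <= Num.sqrt (1 + m%:R * (n%:R - m%:R)) * norm2 (f - U *m U^t* *m f).
Proof.
have Bu := maxvol_rows_unit.
rewrite deim_residual ?tr_selmx_mul//; set g := f - _.
have c0 : 0 <= 1 + m%:R * (n%:R - m%:R) :> R.
  by rewrite addr_ge0// mulr_ge0// subr_ge0 ler_nat ltnW.
apply: norm2_le; first exact: sqrtr_ge0.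
rewrite sqr_sqrtr// /deim_proj -mulmxA !tr_selmx_mul.
have := @interpolation_residual C n m (U *m invmx (rowsub (maxvol_rows U) U))
  (maxvol_rows U) g m0 mn maxvol_rows_inj.
rewrite rmorphD rmorphM rmorphB !rmorph_nat rmorph1; apply.
  by rewrite -mul_rowsub_mx mulmxV.
by move=> i k; apply: maxvol_le1 => // q; apply: maxvol_rows_max.
Qed.

End MaximalVolumeSelection.

Theorem theorem2p1 (R : realType) :
  exists (P : prog) (c : nat) (K : R),
  forall n m : nat, (1 <= m)%N -> (m < n)%N ->
  (* (1) *)
  (forall U : 'M[R[i]]_(n, m), \rank U = m ->
     let S := output P U in
     [/\ (cost P U <= c * (n * m ^ 2))%N,
         is_selection S,
         S^T *m U \in unitmx,
         (* (1a) *)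
         U^t* *m U = 1%:M ->
           spectral_norm (invmx (S^T *m U))
             <= Num.sqrt (n%:R - m%:R + 1)
                * (Num.sqrt (4 ^+ m + 6 * m%:R - 1) / 3)
           /\ (forall f : 'cV[R[i]]_n,
                 norm2 (f - deim_proj U S *m f)
                   <= Num.sqrt n%:R * (K * 2 ^+ m)
                      * norm2 (f - U *m U^t* *m f)) &
         (* (1b) *)
         spectral_norm (invmx (S^T *m U))
           <= Num.sqrt (n%:R - m%:R + 1) / sigma_min U
              * (Num.sqrt (4 ^+ m + 6 * m%:R - 1) / 3)]) /\
  (* (3) for the algorithm of (1) *)
  (forall (U : 'M[R[i]]_(n, m)) (Omega : 'M[R[i]]_m),
     U^t* *m U = 1%:M -> Omega \is unitarymx ->
     output P (U *m Omega) = output P U) /\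
  (* (2), and (3) for S_star *)
  (exists Sstar : 'M[R[i]]_(n, m) -> 'M[R[i]]_(n, m),
     (forall U : 'M[R[i]]_(n, m), U^t* *m U = 1%:M ->
        [/\ is_selection (Sstar U),
            (Sstar U)^T *m U \in unitmx &
            forall f : 'cV[R[i]]_n,
              norm2 (f - deim_proj U (Sstar U) *m f)
                <= Num.sqrt (1 + m%:R * (n%:R - m%:R))
                   * norm2 (f - U *m U^t* *m f)]) /\
     (forall (U : 'M[R[i]]_(n, m)) (Omega : 'M[R[i]]_m),
        U^t* *m U = 1%:M -> Omega \is unitarymx ->
        Sstar (U *m Omega) = Sstar U)).
Proof.
(* The cost constant comes from [8 m + 2 <= 10 m] for [m >= 1], and 2 from [gs_deim_error]. *)
exists pivoted_gs, 10%N, 2 => n m m0 mn; have n0 := ltn_trans m0 mn.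
split.
  move=> U rU S; have Bu := gs_rows_unit n0 rU.
  have SU : S^T *m U = rowsub (fun j : 'I_m => gs_pivot n0 U j) U.
    by rewrite /S (output_gs n0) tr_selmx_mul.
  rewrite SU; split=> //.
  - exact: cost_gs.
  - rewrite /S (output_gs n0); apply: is_selection_selmx; exact: gs_pivot_inj.
  - move=> UU; split.
      (* An isometry satisfies the hypothesis of [gs_spectral_le] with [s = 1], so [sigma_min U]
         need not be computed. *)
      rewrite -[Num.sqrt _ in leRHS]divr1; apply: gs_spectral_le => // z.
      by rewrite expr1n mul1r sqn_isometry.
    by move=> f; rewrite /S (output_gs n0); apply: gs_deim_error.
  - apply: gs_spectral_le => //; first exact: sigma_min_gt0.
    by move=> z; apply: sigma_min_bound.
split; first by move=> U Omega _; apply: output_gs_unitary.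
exists (fun U => selmx R[i] (maxvol_rows m0 mn U)); split=> [U UU|U Omega _ Ou].
  split; [|by rewrite tr_selmx_mul; apply: maxvol_rows_unit
          |by move=> f; apply: maxvol_deim_error].
  exact: is_selection_selmx (maxvol_rows_inj (m0 := m0) (mn := mn) UU).
by rewrite maxvol_rows_unitary.
Qed.
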